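(* Let $\kappa$ be an uncountable regular cardinal and assume that $S \subseteq \kappa$ is a non-reflecting stationary set of $\omega$-limits in $\kappa$. Then there is a $0$-dimensional Fréchet topology $\tau$ on the set $\kappa + 1 = \kappa \cup \{\kappa\}$ such that for the space $X = (\kappa+1, \tau)$ we have $t(X_\delta) = \kappa$.
   Context: A non-reflecting stationary set of $\omega$-limits in $\kappa$ is a stationary subset $S$ of $\kappa$ all of whose elements are limit ordinals of cofinality $\omega$, and such that for every ordinal $\eta < \kappa$ with $\mathrm{cf}(\eta) > \omega$ the set $S \cap \eta$ is not stationary in $\eta$ (i.e. there is a closed unbounded subset of $\eta$ disjoint from $S$). A space is $0$-dimensional if it is $T_2$ (Hausdorff) and has a base consisting of clopen sets. A space is Fréchet if whenever a point $p$ is in the closure of a set $A$, there is a sequence $\langle a_n : n<\omega\rangle$ of points of $A$ converging to $p$. The $G_\delta$-modification $X_\delta$ of a topological space $X$ is the space on the same underlying set whose topology has as a basis the collection of all $G_\delta$ subsets of $X$ (countable intersections of open subsets of $X$). For a point $p$ of a space $Y$, the tightness $t(p,Y)$ is the smallest infinite cardinal $\mu$ such that whenever $A \subseteq Y$ and $p \in \overline{A}$, there is $B \subseteq A$ with $|B| \le \mu$ and $p \in \overline{B}$; the tightness of $Y$ is $t(Y) = \sup\{t(p,Y) : p \in Y\}$. *)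

(* Defs.v *)
From HB Require Import structures.
From mathcomp Require Import all_boot all_order all_algebra.
From mathcomp Require Import all_classical all_reals all_analysis.
From mathcomp Require Import borel_hierarchy.
From mathcomp Require wochoice.

Set Implicit Arguments.
Unset Strict Implicit.
Unset Printing Implicit Defensive.

Import Order.TTheory.

Local Open Scope classical_set_scope.
Local Open Scope card_scope.
Local Open Scope order_scope.

(** Ordinals and cardinals.

    A cardinal kappa is a well-ordered type [K] none of whose proper initial
    segments has as many elements as [K]. An element [x : K] is an ordinal
    below kappa, identified with its set of predecessors [below x], and kappa
    itself is [[set: K]]. The set kappa + 1 is [option K], with [None] standing
    for the point kappa. Cofinalities, cardinals bounding the size of sets and
    tightnesses are arbitrary types, taken up to equipotence. *)

Section Ordinals.
Context {d : Order.disp_t} {K : orderType d}.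
Implicit Types (x eta : K) (D C S : set K).

Definition below x : set K := [set y | y < x].

Definition limit_ordinal x :=
  (exists y, y < x) /\ forall y, y < x -> exists2 z, y < z & z < x.

Definition cofinal D C := C `<=` D /\ forall x, D x -> exists2 y, C y & x <= y.

Definition has_cofinality D (M : Type) :=
  (exists2 C, cofinal D C & C #= [set: M]) /\
  (forall C, cofinal D C -> [set: M] #<= C).

Definition uncountable_cofinality D :=
  exists2 M : Type, has_cofinality D M & ~ countable [set: M].

Definition closed_in D C := forall x, D x -> limit_ordinal x ->
  cofinal (below x) (C `&` below x) -> C x.

(* [club] is only used for [D] without a largest element, where [cofinal] means
   unbounded. *)
Definition club D C := cofinal D C /\ closed_in D C.

Definition stationary D S := forall C, club D C -> S `&` C !=set0.

Definition omega_limit x := limit_ordinal x /\ has_cofinality (below x) nat.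

Definition nonreflecting_stationary_of_omega_limits S :=
  [/\ stationary [set: K] S,
      S `<=` omega_limit
    & forall eta, uncountable_cofinality (below eta) ->
        ~ stationary (below eta) (S `&` below eta)].

End Ordinals.

Definition uncountable_regular_cardinal {d : Order.disp_t} (K : orderType d) :=
  [/\ wochoice.well_order (<=%O : rel K),
      forall x : K, ~ ([set: K] #<= below x),
      ~ countable [set: K]
    & has_cofinality [set: K] K].

Section Spaces.
Variable X : topologicalType.

(* Stronger than the library's [zero_dimensional], which only asks that
   distinct points be separated by a clopen set. *)
Definition T2_clopen_base :=
  hausdorff_space X /\ exists2 B : set (set X), basis B & B `<=` clopen.

Definition Frechet := forall (p : X) (A : set X), closure A p ->
  exists2 a : nat -> X, (forall n, A (a n)) & a n @[n --> \oo] --> p.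

Definition tight_at (p : X) (M : Type) := forall A : set X, closure A p ->
  exists B : set X, [/\ B `<=` A, B #<= [set: M] & closure B p].

Definition has_tightness_at (p : X) (M : Type) :=
  [/\ infinite_set [set: M],
      tight_at p M
    & forall N : Type, infinite_set [set: N] -> tight_at p N ->
        [set: M] #<= [set: N]].

(* The supremum is the least upper bound among cardinals. *)
Definition has_tightness (M : Type) :=
  (forall (p : X) (N : Type), has_tightness_at p N -> [set: N] #<= [set: M]) /\
  (forall L : Type,
     (forall (p : X) (N : Type), has_tightness_at p N ->
        [set: N] #<= [set: L]) ->
     [set: M] #<= [set: L]).

End Spaces.

Definition Gdelta_modification (X : topologicalType) : Type := X.

Section GdeltaModification.
Variable X : topologicalType.

Local Lemma Gdelta_cover : \bigcup_(A in @Gdelta X) A = [set: X].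
Proof.
rewrite predeqE => x; split=> // _; exists [set: X] => //.
exact/open_Gdelta/openT.
Qed.

Local Lemma Gdelta_join (A B : set X) x : Gdelta A -> Gdelta B -> A x -> B x ->
  exists C : set X, [/\ Gdelta C, C x & C `<=` A `&` B].
Proof.
move=> [F oF ->] [G oG ->] Fx Gx.
exists (\bigcap_i (F i `&` G i)); split.
- by exists (fun i => F i `&` G i) => // i; exact: openI.
- by move=> i _; split; [exact: Fx|exact: Gx].
- by move=> y FGy; split=> i _; have [] := FGy i I.
Qed.

HB.instance Definition _ := Choice.on (Gdelta_modification X).
HB.instance Definition _ := isBaseTopological.Build (Gdelta_modification X)
  Gdelta_cover Gdelta_join.

Lemma basis_Gdelta : @basis (Gdelta_modification X) (@Gdelta X).
Proof.
split=> [A GA|x A]; first by exists [set A]; [move=> ? ->|rewrite bigcup_set1].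
move=> [_ [[D GD <-] [B DB Bx] DA]]; exists B; first by split=> //; exact: GD.
by move=> y By; apply: DA; exists B.
Qed.

End GdeltaModification.

(* Main.v *)
Require Import Defs.
From HB Require Import structures.
From mathcomp Require Import all_boot all_order all_algebra.
From mathcomp Require Import all_classical all_reals all_analysis.
From mathcomp Require Import borel_hierarchy.
From mathcomp Require wochoice.

Set Implicit Arguments.
Unset Strict Implicit.
Unset Printing Implicit Defensive.

Import Order.TTheory.

Local Open Scope classical_set_scope.
Local Open Scope card_scope.
Local Open Scope order_scope.

(** Points of kappa are isolated, and the neighbourhoods of the point kappa are
    the complements of the members of the ideal I of those sets whose trace
    below every alpha in S is bounded in alpha. Everything is then a property
    of I.

    The space is Frechet because a set outside I is unbounded in some alpha in
    S, hence contains an omega-sequence cofinal in alpha, and such a sequence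
    meets every member of I in a finite set.

    In the G_delta-modification, kappa is in the closure of a set of isolated
    points exactly when this set is not a countable union of members of I. Two
    facts decide that its tightness is kappa.
    - kappa itself is not such a union ([not_sigma_trace_bounded_setT]): one of
      countably many sets covering kappa is unbounded, its limit points form a
      club, and the stationary set S meets this club.
    - Every bounded set is such a union ([below_sigma_trace_bounded]), by
      induction on its bound eta. If eta has countable cofinality, countably
      many smaller initial segments and points cover eta. Otherwise
      non-reflection gives a club C in eta disjoint from S, and the
      decompositions of the intervals between consecutive points of C can be
      glued: a point of S below eta is neither in C nor a limit of C, so that
      only one of the glued pieces has points just below it.
    As kappa is regular, sets of size less than kappa are bounded, so none of
    them has kappa in its closure, although the set of all isolated points
    does. *)

(** * Least cardinals *)

(** By Zorn's lemma there is a maximal set [G] of choice functions for [F] no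
    two of which agree anywhere on [F]. If for every member of [F] some point
    were not a value of [G] there, these points would make a new choice
    function. So [G] maps onto some member of [F], and it maps injectively into
    the others. *)
Lemma card_le_least (T : Type) (F : set (set T)) : F !=set0 ->
  exists2 A, F A & forall B, F B -> A #<= B.
Proof.
move=> [A1 FA1].
pose P (G : set (set T -> T)) :=
  (forall g, G g -> forall A, F A -> A (g A)) /\
  (forall g h, G g -> G h -> forall A, F A -> g A = h A -> g = h).
have [G [[GF Ginj] Gmax]] : exists G, P G /\ forall H, G `<` H -> ~ P H.
  apply: Zorn_bigcup => C CP Ctot; split.
    by move=> g [X CX Xg]; exact: (CP _ CX).1.
  move=> g h [X CX Xg] [Y CY Yh].
  have [XY|YX] := Ctot _ _ CX CY.
    by apply: (CP _ CY).2 => //; exact: XY.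
  by apply: (CP _ CX).2 => //; exact: YX.
have [A FA AG] : exists2 A, F A & forall x, A x -> exists2 g, G g & g A = x.
  apply: contrapT => noA.
  have new A : exists x, F A -> A x /\ forall g, G g -> g A <> x.
    have ex B : F B -> exists x, B x /\ forall g, G g -> g B <> x.
      move=> FB; apply: contrapT => nox; apply: noA; exists B => // x Bx.
      apply: contrapT => nog; apply: nox; exists x; split=> // g Gg gBx.
      by apply: nog; exists g.
    have [FA|nFA] := pselect (F A); first by have [x ?] := ex A FA; exists x.
    by have [x _] := ex A1 FA1; exists x.
  have [h hP] := choice new.
  have GGh : G `<` G `|` [set h].
    split; first exact: subsetUl.
    move=> GhG; have Gh : G h by apply: GhG; right.
    exact: (hP A1 FA1).2 _ Gh erefl.
  apply: (Gmax _ GGh); split=> [g [Gg|->] B FB|g k [Gg|->] [Gk|->] B FB] //.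
  - exact: (GF _ Gg).
  - exact: (hP B FB).1.
  - exact: Ginj.
  - by move/((hP B FB).2 _ Gg).
  - by move=> /esym/((hP B FB).2 _ Gk).
exists A => // B FB.
have sec x : exists g : set T -> T, A x -> G g /\ g A = x.
  have [/AG[g Gg gA]|nAx] := pselect (A x); first by exists g.
  by exists (fun=> x).
have [s sP] := choice sec.
suff /injfunPex[f] : exists2 f : T -> T, set_fun A B f & set_inj A f.
  exact: inj_card_le f.
exists (fun x => s x B) => [x Ax|x y /set_mem Ax /set_mem Ay sxy].
  exact: (GF _ (sP _ Ax).1).
rewrite -(sP _ Ax).2 -(sP _ Ay).2; congr (_ A).
exact: (Ginj _ _ (sP _ Ax).1 (sP _ Ay).1 B FB sxy).
Qed.

Section Ordinals.
Context {d : Order.disp_t} {K : orderType d}.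
Hypothesis wo : wochoice.well_order (<=%O : rel K).
Implicit Types (x y z a eta : K) (A B C D S : set K).

(** * Well-ordered types and cofinality *)

Lemma well_order_least A : A !=set0 ->
  exists2 x, A x & forall y, A y -> x <= y.
Proof.
move=> [x Ax]; have [|z [[zA zmin] _]] := wo (A := [pred y | `[< A y >]]).
  by exists x; exact/asboolP.
by exists z => [|y Ay]; [exact/asboolP|exact/zmin/asboolP].
Qed.

Lemma well_order_ind (P : K -> Prop) :
  (forall x, (forall y, y < x -> P y) -> P x) -> forall x, P x.
Proof.
move=> Pind x; apply: contrapT => nPx.
have [|y nPy ymin] := @well_order_least (fun y => ~ P y); first by exists x.
apply: nPy; apply: Pind => z zy; apply: contrapT => /ymin.
by rewrite leNgt zy.
Qed.

Lemma not_cofinal D C : C `<=` D -> ~ cofinal D C ->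
  exists2 x, D x & forall y, C y -> y < x.
Proof.
move=> CD ncof; apply: contrapT => nx; apply: ncof; split=> // x Dx.
apply: contrapT => ny; apply: nx; exists x => // y Cy.
by rewrite ltNge; apply/negP => xy; apply: ny; exists y.
Qed.

Lemma cofinal_id D : cofinal D D.
Proof. by split=> // x Dx; exists x. Qed.

(** An uncountable cofinality is witnessed by a cofinal set of least
    cardinality, which has to be found first. *)
Lemma uncountable_cofinalityP D :
  (forall C, cofinal D C -> ~ countable C) -> uncountable_cofinality D.
Proof.
move=> unc; have [|C cofC Cmin] := @card_le_least K (cofinal D).
  by exists D; exact: cofinal_id.
exists (set_type C).
  split=> [|B cofB]; first by exists C => //; rewrite card_eq_sym card_setT.
  by rewrite (card_le_eql (card_setT C)); exact: Cmin.
by rewrite (eq_countable (card_setT C)); exact: unc.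
Qed.

Lemma omega_limit_countable a : omega_limit a ->
  exists2 C, cofinal (below a) C & countable C.
Proof.
by move=> [_ [[C cofC Cnat] _]]; exists C => //; rewrite (eq_countable Cnat).
Qed.

(** * The ideal of sets with bounded traces *)

Definition trace_bounded S B := forall a, S a ->
  exists2 y, y < a & forall z, B z -> z < a -> z <= y.

Definition sigma_trace_bounded S A := exists2 B : nat -> set K,
  forall n, trace_bounded S (B n) & A `<=` \bigcup_n B n.

Section Ideal.
Variable S : set K.
Hypothesis Slim : S `<=` omega_limit.

Lemma trace_bounded_sub A B : A `<=` B -> trace_bounded S B ->
  trace_bounded S A.
Proof. by move=> AB bB a /bB[y ya yP]; exists y => // z /AB; exact: yP. Qed.

Lemma trace_bounded0 : trace_bounded S set0.
Proof. by move=> a /Slim[[[y ya] _] _]; exists y. Qed.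

Lemma trace_boundedU A B : trace_bounded S A -> trace_bounded S B ->
  trace_bounded S (A `|` B).
Proof.
move=> bA bB a Sa; have [x xa xP] := bA a Sa; have [y ya yP] := bB a Sa.
exists (Order.max x y); first by rewrite gt_max xa.
by move=> z [/xP|/yP] zP /zP; rewrite le_max => ->; rewrite ?orbT.
Qed.

Lemma trace_bounded1 x : trace_bounded S [set x].
Proof.
move=> a Sa; have [[[y ya] _] _] := Slim Sa.
have [xa|ax] := ltP x a; first by exists x => // z ->.
by exists y => // z ->; rewrite ltNge ax.
Qed.

Lemma trace_bounded_sigma A : trace_bounded S A -> sigma_trace_bounded S A.
Proof. by move=> bA; exists (fun=> A) => // x Ax; exists 0%N. Qed.

Lemma sigma_trace_bounded_sub A B : A `<=` B -> sigma_trace_bounded S B ->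
  sigma_trace_bounded S A.
Proof. by move=> AB [F bF BF]; exists F => // x /AB/BF. Qed.

Lemma sigma_trace_bounded_bigcup (I : Type) (D : set I) (F : I -> set K) :
  countable D -> (forall i, D i -> sigma_trace_bounded S (F i)) ->
  sigma_trace_bounded S (\bigcup_(i in D) F i).
Proof.
move=> /countable_injP[e einj] bF.
have ex n : exists B : nat -> set K, (forall k, trace_bounded S (B k)) /\
    forall i, D i -> e i = n -> F i `<=` \bigcup_k B k.
  have [[i Di ein]|no] := pselect (exists2 i, D i & e i = n).
    have [B bB FB] := bF i Di; exists B; split=> // j Dj ejn.
    by rewrite (einj j i) ?inE// ein.
  exists (fun=> set0); split=> [_|i Di ein]; first exact: trace_bounded0.
  by case: no; exists i.
have [B BP] := choice ex.
exists (fun m => if unpickle m is Some (n, k) then B n k else set0) => [m|x].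
  by case: unpickle => [[n k]|]; [exact: (BP n).1|exact: trace_bounded0].
move=> [i Di Fix]; have [k _ Bx] := (BP (e i)).2 i Di erefl x Fix.
by exists (pickle (e i, k)) => //; rewrite pickleK.
Qed.

(** The least point of [C] above [z] serves as the index of the interval of [C]
    containing [z]. It is constant near each [a] in [S], since [a] is not a
    limit of [C]. *)
Lemma sigma_trace_bounded_club eta C :
  (forall c, c < eta -> sigma_trace_bounded S (below c)) ->
  (forall D, cofinal (below eta) D -> ~ countable D) ->
  club (below eta) C -> S `&` C = set0 ->
  sigma_trace_bounded S (below eta).
Proof.
move=> IH unc [[Ceta Ccof] Ccl] SC.
have next z : exists c, z < eta ->
    [/\ C c, z < c & forall c', C c' -> z < c' -> c <= c'].
  have [zeta|nz] := pselect (z < eta); last by exists z.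
  have [|c [Cc zc] cmin] := @well_order_least (fun c => C c /\ z < c).
  (* Otherwise [z] is the largest element of [below eta]. *)
    apply: contrapT => noc; apply: (unc [set z]); last exact: countable1.
    split=> [_ ->//|x xeta]; exists z => //.
    have [c Cc xc] := Ccof x xeta; rewrite leNgt; apply/negP => zx.
    by apply: noc; exists c; split=> //; exact: lt_le_trans xc.
  by exists c => _; split=> // c' Cc' zc'; exact: cmin.
have [c cP] := choice next.
have pieces x : exists B : nat -> set K, x < eta ->
    (forall n, trace_bounded S (B n)) /\ below x `<=` \bigcup_n B n.
  have [xeta|nx] := pselect (x < eta); last by exists (fun=> set0).
  by have [B bB xB] := IH x xeta; exists B.
have [B BP] := choice pieces.
exists (fun n => [set z | z < eta /\ B (c z) n z]); last first.
  move=> z zeta; have [Cc zc _] := cP z zeta.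
  have [n _ Bz] := (BP _ (Ceta _ Cc)).2 z zc.
  by exists n.
move=> n a Sa; have [[[y0 y0a] alim] _] := Slim Sa.
have [aeta|etaa|aeta] := ltgtP a eta; last first.
  (* [eta] has uncountable cofinality, so it is not in [S]. *)
  have [D] := omega_limit_countable (Slim Sa).
  by rewrite aeta => /unc.
  by exists eta => // z [/ltW].
have [x xa xP] : exists2 x, x < a & forall y, C y -> y < a -> y < x.
  have nCa : ~ C a.
    by move=> Ca; have : (S `&` C) a by []; rewrite SC.
  have [||x xa xP] := @not_cofinal (below a) (C `&` below a).
  - exact: subIsetr.
  - by move=> cofa; apply: nCa; apply: Ccl => //; exact: (Slim Sa).1.
  by exists x => // y Cy ya; exact: xP.
have [Ccx xcx cxmin] := cP x (lt_trans xa aeta).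
have [y ya yP] := (BP _ (Ceta _ Ccx)).1 n a Sa.
exists (Order.max x y); first by rewrite gt_max xa.
move=> z [zeta Bz] za; rewrite le_max.
have [/ltW->//|xz] := ltP z x; apply/orP; right.
suff czx : c z = c x by apply: yP => //; rewrite -czx.
have acx u : C u -> x < u -> a <= u.
  move=> Cu xu; rewrite leNgt; apply/negP => ua.
  by have := xP u Cu ua; rewrite ltNge (ltW xu).
have [Ccz zcz czmin] := cP z zeta.
apply/le_anti/andP; split.
  by apply: czmin => //; exact: lt_le_trans za (acx _ Ccx xcx).
by apply: cxmin => //; exact: le_lt_trans xz zcz.
Qed.

(** The trace of [below eta] on [eta] itself is unbounded when [eta] is in [S],
    so one piece need not suffice. Only when [eta] has uncountable
    cofinality do the decompositions of smaller segments fail to combine by a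
    mere countable union, and this is where non-reflection is used. *)
Lemma below_sigma_trace_bounded :
  (forall eta, uncountable_cofinality (below eta) ->
     ~ stationary (below eta) (S `&` below eta)) ->
  forall eta, sigma_trace_bounded S (below eta).
Proof.
move=> nonrefl; apply: well_order_ind => eta IH.
have [[D cofD cD]|unc] :=
    pselect (exists2 D, cofinal (below eta) D & countable D).
  apply: (@sigma_trace_bounded_sub _ (\bigcup_(c in D) ([set c] `|` below c))).
    move=> x /cofD.2[c Dc]; rewrite le_eqVlt => /orP[/eqP->|xc].
      by exists c => //; left.
    by exists c => //; right.
  apply: sigma_trace_bounded_bigcup => // c Dc.
  rewrite (_ : _ `|` _ =
    \bigcup_(b in [set: bool]) (if b then [set c] else below c)).
    apply: sigma_trace_bounded_bigcup => // -[] _.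
      by apply: trace_bounded_sigma; exact: trace_bounded1.
    by apply: IH; exact: cofD.1.
  apply/seteqP; split=> [x [xc|xc]|x [[] _ xc]].
  - by exists true.
  - by exists false.
  - by left.
  - by right.
have {}unc D : cofinal (below eta) D -> ~ countable D.
  by move=> cofD cD; apply: unc; exists D.
have /existsNP[C /not_implyP[clubC SC]] :=
  nonrefl eta (uncountable_cofinalityP unc).
apply: (sigma_trace_bounded_club IH unc clubC).
apply/seteqP; split=> // x [Sx Cx]; apply: SC; exists x; split=> //; split=> //.
exact: clubC.1.1.
Qed.

End Ideal.

(** * Regular cardinals *)

Section Regular.
Hypothesis regK : has_cofinality [set: K] K.
Hypothesis uncK : ~ countable [set: K].

Lemma small_bounded A : ~ ([set: K] #<= A) -> exists x, A `<=` below x.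
Proof.
move=> smallA; have [||x _ xP] := @not_cofinal setT A => //.
  by move=> /regK.2.
by exists x.
Qed.

Lemma countable_bounded A : countable A -> exists x, A `<=` below x.
Proof.
move=> cA; apply: small_bounded => KA; apply: uncK.
exact: sub_countable KA cA.
Qed.

(** An unbounded set [B] has a club of limit points: from any [x], climb
    omega many steps inside [B] and take the supremum. *)
Lemma club_limit_points B : (forall x, exists2 z, B z & x < z) ->
  club [set: K] [set a | forall y, y < a -> exists2 z, B z & y < z < a].
Proof.
move=> unbB; split.
  split=> // x _.
  have /choice[f fP] : forall y, exists z, B z /\ y < z.
    by move=> y; have [z] := unbB y; exists z.
  pose s n := iter n f x.
  have [u uP] : exists u, range s `<=` below u.
    exact/countable_bounded/(sub_countable (card_image_le _ _)).
  have [|a sa amin] := @well_order_least (fun a => forall n, s n <= a).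
    by exists u => n; apply/ltW/uP; exists n.
  exists a; last exact: sa 0%N.
  move=> y ya.
  have [n yn] : exists n, y < s n.
    apply: contrapT => non; have : a <= y.
      by apply: amin => n; rewrite leNgt; apply/negP => yn; apply: non;
         exists n.
    by rewrite leNgt ya.
  exists (s n.+1); first exact: (fP _).1.
  rewrite (lt_trans yn (fP _).2) /=.
  exact: lt_le_trans (fP (s n.+1)).2 (sa n.+2).
move=> a _ alim cof y ya; have [y' yy' y'a] := alim.2 y ya.
have [c [Cc ca] y'c] := cof.2 y' y'a.
have [z Bz /andP[yz zc]] := Cc y (lt_le_trans yy' y'c).
by exists z => //; rewrite yz (lt_trans zc).
Qed.

(** By regularity one of countably many sets covering [K] is unbounded; a point
    of [S] that is a limit of this set contradicts its bounded traces. *)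
Lemma not_sigma_trace_bounded_setT S : stationary [set: K] S ->
  ~ sigma_trace_bounded S [set: K].
Proof.
move=> statS [B bB cover].
have [n unb] : exists n, forall x, exists2 z, B n z & x < z.
  apply: contrapT => bnd.
  have ex n : exists x, forall z, B n z -> z <= x.
    apply: contrapT => nox; apply: bnd; exists n => x.
    apply: contrapT => noz; apply: nox; exists x => z Bz.
    by rewrite leNgt; apply/negP => xz; apply: noz; exists z.
  have [x xP] := choice ex.
  have [u uP] : exists u, range x `<=` below u.
    exact/countable_bounded/(sub_countable (card_image_le _ _)).
  have [n _ /xP un] := cover u I.
  have : x n < u by apply: uP; exists n.
  by rewrite ltNge un.
have [a [Sa aP]] := statS _ (club_limit_points unb).
have [y ya yP] := bB n a Sa.
have [z Bz /andP[yz za]] := aP y ya.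
by have := yP z Bz za; rewrite leNgt yz.
Qed.

End Regular.

(** * The sequence converging out of an unbounded trace *)

(** [omega_limit] gives a cofinal set enumerated by [nat] in any order; running
    maxima make the enumeration nondecreasing, so that the points of [A] chosen
    above them and below [a] converge to [a]. *)
Lemma unbounded_trace_sequence S A : S `<=` omega_limit ->
  ~ trace_bounded S A ->
  exists2 f : nat -> K, (forall n, A (f n)) &
    forall B, trace_bounded S B ->
      exists N, forall n, (N <= n)%N -> ~ B (f n).
Proof.
move=> Slim /existsNP[a /not_implyP[Sa unb]].
have [_ [[C [Ca Ccof] Cnat] _]] := Slim a Sa.
have /card_set_bijP[e [_ einj esurj]] := Cnat.
have /choice[c cP] : forall n, exists x, C x /\ e x = n.
  by move=> n; have [x Cx ex] := esurj n I; exists x.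
have ca n : c n < a by apply: Ca; exact: (cP n).1.
pose m := fix m n := if n is n'.+1 then Order.max (m n') (c n) else c 0%N.
have ma n : m n < a by elim: n => [|n IH] //=; rewrite gt_max IH ca.
have cm k n : (k <= n)%N -> c k <= m n.
  elim: n => [|n IH] /=; first by rewrite leqn0 => /eqP ->.
  by rewrite leq_eqVlt le_max => /orP[/eqP->|/IH->//]; rewrite lexx orbT.
have ex n : exists z, A z /\ m n < z < a.
  apply: contrapT => noz; apply: unb; exists (m n) => // z Az za.
  rewrite leNgt; apply/negP => mz; apply: noz; exists z.
  by rewrite mz za.
have [f fP] := choice ex.
exists f => [n|B bB]; first exact: (fP n).1.
have [y ya yP] := bB a Sa.
have [x Cx yx] := Ccof y ya; pose N := e x.
have ycN : y <= c N.
  by rewrite (einj (c N) x) ?inE//; [exact: (cP N).1|exact: (cP N).2].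
exists N => n Nn Bf; have /andP[mf fa] := (fP n).2.
have := yP _ Bf fa; rewrite leNgt.
by rewrite (le_lt_trans (le_trans ycN (cm _ _ Nn)) mf).
Qed.

End Ordinals.

(** * The space *)

(** [Slim] is a parameter of the type so that the topology, whose axioms rely on
    it, can be attached to it as an instance. *)
Definition trace_space (d : Order.disp_t) (K : orderType d) (S : set K)
  (Slim : S `<=` omega_limit) : Type := option K.

Section TraceSpace.
Context (d : Order.disp_t) (K : orderType d) (S : set K).
Variable Slim : S `<=` omega_limit.
Local Notation X := (trace_space Slim).

Definition trace_open (U : set X) :=
  U None -> trace_bounded S [set x | ~ U (Some x)].

Lemma trace_openT : trace_open setT.
Proof.
move=> _; apply: trace_bounded_sub (trace_bounded0 Slim).
by move=> x /= /(_ I).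
Qed.

Lemma trace_openI : setI_closed trace_open.
Proof.
move=> U V oU oV [/oU bU /oV bV].
apply: trace_bounded_sub (trace_boundedU bU bV).
by move=> x /= /not_andP.
Qed.

Lemma trace_open_bigcup (I : Type) (F : I -> set X) :
  (forall i, trace_open (F i)) -> trace_open (\bigcup_i F i).
Proof.
move=> oF [i _ /oF]; apply: trace_bounded_sub => x /= nF Fx.
by apply: nF; exists i.
Qed.

HB.instance Definition _ := Choice.copy X (option K).
HB.instance Definition _ := isOpenTopological.Build X
  trace_openT trace_openI trace_open_bigcup.

Lemma open_traceE (U : set X) : open U = trace_open U.
Proof. by []. Qed.

Lemma open_without_infinity (U : set X) : ~ U None -> open U.
Proof. by move=> nU; rewrite open_traceE => /nU. Qed.

Lemma closed_with_infinity (U : set X) : U None -> closed U.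
Proof. by move=> UN; rewrite -openC; apply: open_without_infinity. Qed.

Lemma closed_trace_bounded (B : set K) : trace_bounded S B ->
  @closed X (Some @` B).
Proof.
move=> bB; rewrite -openC open_traceE => _.
by apply: trace_bounded_sub bB => x /contrapT[y By [<-]].
Qed.

Lemma clopen_point (x : K) : @clopen X [set Some x].
Proof.
split; first exact: open_without_infinity.
by rewrite -image_set1; apply: closed_trace_bounded; exact: trace_bounded1.
Qed.

(** Every set containing the point at infinity is closed, as its complement
    consists of isolated points. So all open neighbourhoods of this point are
    clopen already. *)
Lemma T2_clopen_base_trace_space : T2_clopen_base X.
Proof.
split.
  rewrite open_hausdorff => p q pq.
  wlog [x px] : p q pq / exists x, p = Some x.
    move=> sep; case: p pq => [x|] pq; first by apply: sep => //; exists x.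
    case: q pq => [y|]; last by rewrite eqxx.
    rewrite eq_sym => /sep[|[A B] /= [pA qB] [oA oB AB]]; first by exists y.
    by exists (B, A) => //=; split=> //; rewrite setIC.
  have [op cl] := clopen_point x.
  have qNp : (~` [set p]) q by move=> /= qp; rewrite qp eqxx in pq.
  exists ([set p], ~` [set p]); last first.
    by rewrite px; split=> //; [exact: closed_openC|rewrite setICr].
  by split; apply: mem_set.
exists clopen => //; split=> [A []//|p U].
rewrite nbhsE => -[V [oV Vp] VU]; rewrite /= /filter_from /=.
case: p Vp => [x|] Vp.
  exists [set Some x]; first by split=> //; exact: clopen_point.
  by move=> _ ->; exact: VU.
by exists V => //; split=> //; split=> //; exact: closed_with_infinity.
Qed.

Lemma Frechet_trace_space : Frechet X.
Proof.
move=> p A clA.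
have [Ap|nAp] := pselect (A p); first by exists (fun=> p) => //; exact: cvg_cst.
case: p clA nAp => [x|] clA nAp.
  have [|y [Ay /= yx]] := clA [set Some x].
    by apply: open_nbhs_nbhs; split=> //; exact: (clopen_point x).1.
  by rewrite yx in Ay.
have unb : ~ trace_bounded S [set x | A (Some x)].
  move=> bA; have [|[x|] [Ax nx]] := clA (~` (Some @` [set x | A (Some x)])).
    apply: open_nbhs_nbhs; split; last by move=> [].
    by apply: closed_openC; exact: closed_trace_bounded.
    by apply: nx; exists x.
  exact: nAp.
have [f fA fcvg] := unbounded_trace_sequence Slim unb.
exists (fun n => Some (f n)) => // U; rewrite nbhsE => -[V [oV VN] VU].
have [N NP] := fcvg _ (oV VN).
by exists N => // n Nn; apply: VU; apply: contrapT; exact: NP.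
Qed.

(** * The G_delta-modification *)

Local Notation Xd := (Gdelta_modification X).

Lemma open_Gdelta_modification (T : topologicalType) (U : set T) :
  Gdelta U -> @open (Gdelta_modification T) U.
Proof. exact: (basis_Gdelta T).1. Qed.

Lemma nbhs_Gdelta_modificationP (T : topologicalType) (p : T) (U : set T) :
  nbhs (p : Gdelta_modification T) U ->
  exists F : nat -> set T, [/\ forall n, open (F n), forall n, F n p &
    \bigcap_n F n `<=` U].
Proof.
move=> /((basis_Gdelta T).2 p)[_ [[F oF ->] Fp] FU].
by exists F; split=> // n; exact: Fp.
Qed.

(** A G_delta neighbourhood of the point at infinity removes countably many
    members of the ideal, one for each open set of the intersection. *)
Lemma closure_Gdelta_infinity (A : set K) :
  @closure Xd (Some @` A) None <-> ~ sigma_trace_bounded S A.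
Proof.
split=> [clA [B bB AB]|nA U /nbhs_Gdelta_modificationP[F [oF FN FU]]].
  have [|_ [[x Ax <-] xP]] := clA (\bigcap_n ~` (Some @` B n)).
    apply: open_nbhs_nbhs; split; last by move=> n _; move=> [].
    apply: open_Gdelta_modification; exists (fun n => ~` (Some @` B n)) => // n.
    by apply: closed_openC; exact: closed_trace_bounded.
  by have [n _ Bx] := AB x Ax; apply: (xP n I); exists x.
apply: contrapT => disj; apply: nA.
exists (fun n => [set x | ~ F n (Some x)]) => [n|x Ax].
  exact: (oF n (FN n)).
apply: contrapT => nx; apply: disj; exists (Some x); split; first by exists x.
by apply: FU => n _; apply: contrapT => nF; apply: nx; exists n.
Qed.

Lemma nbhs_Gdelta_point (x : K) : nbhs (Some x : Xd) [set Some x].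
Proof.
apply: open_nbhs_nbhs; split=> //; apply: open_Gdelta_modification.
exact/open_Gdelta/(clopen_point x).1.
Qed.

Lemma tight_at_Gdelta_point (x : K) : @tight_at Xd (Some x) nat.
Proof.
move=> A /(_ _ (nbhs_Gdelta_point x))[y [Ay /= yx]].
exists [set Some x]; split=> [_ ->||].
- by rewrite -yx.
- exact: countable1.
- exact: subset_closure.
Qed.

Hypothesis wo : wochoice.well_order (<=%O : rel K).
Hypothesis regK : has_cofinality [set: K] K.
Hypothesis uncK : ~ countable [set: K].
Hypothesis nonreflS : nonreflecting_stationary_of_omega_limits S.

Lemma infinite_K : infinite_set [set: K].
Proof. by move=> /finite_set_countable. Qed.

(** The set of all isolated points is the one that has [None] in its closure
    without any smaller subset doing so. *)
Lemma has_tightness_at_Gdelta_infinity : @has_tightness_at Xd None K.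
Proof.
have [statS _ nonrefl] := nonreflS.
split; first exact: infinite_K.
  move=> A clA; have [AN|nAN] := pselect (A None).
    exists [set None]; split=> [_ ->//||]; last exact: subset_closure.
    rewrite (card_le_trans (B := [set: nat]))//; first exact: countable1.
    exact/infiniteP/infinite_K.
  exists A; split=> //.
  have -> : A = Some @` [set x | A (Some x)].
    apply/seteqP; split=> [[x|] Ax|_ [x Ax <-]//]; first by exists x.
    by case: nAN.
  by rewrite card_ge_some; exact: card_leT.
move=> N infN tightN.
have [|B [Brange BN clB]] := tightN (range Some).
  by apply/closure_Gdelta_infinity; exact: not_sigma_trace_bounded_setT.
have BE : B = Some @` [set x | B (Some x)].
  apply/seteqP; split=> [y By|_ [x Bx <-]//].
  by have [x _ xy] := Brange y By; exists x => //=; rewrite xy.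
apply: contrapT => smallN.
have [|u uP] := @small_bounded _ K regK [set x | B (Some x)].
  move=> KB; apply: smallN; apply: card_le_trans BN.
  by rewrite BE card_le_some.
move: clB; rewrite BE => /closure_Gdelta_infinity; apply.
apply: sigma_trace_bounded_sub uP _.
exact: below_sigma_trace_bounded.
Qed.

Lemma has_tightness_Gdelta_trace_space : has_tightness Xd K.
Proof.
split=> [[x|] N [_ _ Nmin]|L Lub]; last first.
- exact: Lub has_tightness_at_Gdelta_infinity.
- have [infK tightK _] := has_tightness_at_Gdelta_infinity.
  exact: Nmin.
apply: card_le_trans (Nmin nat infinite_nat (@tight_at_Gdelta_point x)) _.
exact/infiniteP/infinite_K.
Qed.

End TraceSpace.

Theorem theorem3p1 (d : Order.disp_t) (K : orderType d) (S : set K) :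
  uncountable_regular_cardinal K ->
  nonreflecting_stationary_of_omega_limits S ->
  exists tau : Topological (option K),
    let X : topologicalType := Topological.Pack tau in
    [/\ T2_clopen_base X, Frechet X & has_tightness (Gdelta_modification X) K].
Proof.
move=> [wo _ uncK regK] nonreflS; have [_ Slim _] := nonreflS.
exists (Topological.class (trace_space Slim)); split.
- exact: T2_clopen_base_trace_space.
- exact: Frechet_trace_space.
- exact: has_tightness_Gdelta_trace_space.
Qed.
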